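(* Let $n\in\mathbb{N}$, $k\in\{2,4,8,10\}$ and $x=12n+k$. Put $n_1=n+1$ if $k=8$ and $n_1=n$ if $k\in\{2,4,10\}$; $b=6$ if $k\in\{4,8\}$ and $b=12$ if $k\in\{2,10\}$; $c=1$ if $k\in\{4,10\}$ and $c=-1$ if $k\in\{2,8\}$. Then the degree of $x$ in the near Goldbach graph $G(x/2)$ is $n_1+1-f(n)$ if $x-3$ is prime and $n_1-f(n)$ if $x-3$ is not prime, where $$f(n)=\left|\bigcup_{\substack{p\text{ prime}\\ 3<p<\sqrt{x}}}\left(F(x,p,+)\cup F(x,p,-)\right)\right|,$$ and, for every prime $p$ with $3<p<\sqrt{x}$, $$|F(x,p,+)\cup F(x,p,-)|=\begin{cases}\lfloor (n_1-k_1)/p\rfloor+1, & p\mid x,\\ \lfloor (n_1-k_1)/p\rfloor+\lfloor (n_1-k_2)/p\rfloor+1, & p\nmid x \text{ and } 3\mid p+c,\\ \lfloor (n_1-k_1)/p\rfloor+\lfloor (n_1-k_2)/p\rfloor+2, & p\nmid x\text{ and } 3\nmid p+c,\end{cases}$$ with $k_1=[(p-[x]_p^1-b)\cdot 12^{p-2}]_p+1$ and $k_2=[(x-b)\cdot 12^{p-2}]_p+1$.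
   Context: $\mathbb{N}$ denotes the positive integers. For $N\in\mathbb{N}$, the near Goldbach graph $G(N)$ is the simple undirected graph with vertex set $\{2,4,\ldots,2N\}$ in which two distinct vertices $a,b$ are adjacent iff both $\frac{a+b}{2}$ and $\frac{|a-b|}{2}$ lie in $\{q: q\text{ prime},\ 2<q<2N\}\cup\{1\}$. For an integer $a$, $[a]_p$ is the element of $\{0,1,\ldots,p-1\}$ congruent to $a$ modulo $p$, and $[a]_p^1$ is the element of $\{1,2,\ldots,p\}$ congruent to $a$ modulo $p$. For $x=12n+k$ let $S$ be the set $\{12m+6: 0\le m\le n-1\}$ if $k=4$, $\{12m+6: 0\le m\le n\}$ if $k=8$, and $\{12m: 1\le m\le n\}$ if $k\in\{2,10\}$ ($m$ an integer). For a prime $p$ with $3<p<\sqrt{x}$, $F(x,p,+)=\{y\in S: p\mid x+y\}$ and $F(x,p,-)=\{y\in S: p\mid x-y,\ x-y\ne 2p\}$. *)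

(* Defs.v *)
From mathcomp Require Import all_boot all_order all_algebra.
From mathcomp Require Export finmap.

Set Implicit Arguments.
Unset Strict Implicit.
Unset Printing Implicit Defensive.

Local Open Scope fset_scope.
Local Open Scope nat_scope.

(* A finite simple graph whose vertices are elements of an ambient type [K];
   [adj] is only meaningful between elements of [vertices]. *)
Record sgraph (K : choiceType) := SGraph {
  vertices : {fset K};
  adj : rel K;
  adj_sym : symmetric adj;
  adj_irr : irreflexive adj
}.

Definition degree (K : choiceType) (G : sgraph K) (v : K) : nat :=
  #|` [fset w in vertices G | adj G v w]|.

Definition odd_prime_below_or_1 (M q : nat) : bool :=
  [&& prime q, 2 < q & q < M] || (q == 1).

(* Vertices are even, so the two halvings below are exact. *)
Definition near_goldbach_adj (N : nat) : rel nat := fun a b =>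
  [&& a != b,
      odd_prime_below_or_1 (2 * N) (a + b)./2 &
      odd_prime_below_or_1 (2 * N) (`|(a%:Z - b%:Z)%R|%N)./2].

Lemma near_goldbach_adj_sym N : symmetric (near_goldbach_adj N).
Proof.
by move=> a b; rewrite /near_goldbach_adj eq_sym addnC distnC.
Qed.

Lemma near_goldbach_adj_irr N : irreflexive (near_goldbach_adj N).
Proof. by move=> a; rewrite /near_goldbach_adj eqxx. Qed.

Definition near_goldbach (N : nat) : sgraph nat :=
  SGraph [fset 2 * i | i in iota 1 N]
         (@near_goldbach_adj_sym N) (@near_goldbach_adj_irr N).

(* For positive [p], [%%] on [int] is the remainder in {0, ..., p - 1} also
   for negative [a], and [%/] is the floor of the quotient. *)
Definition res0 (a : int) (p : nat) : int := (a %% p%:Z%R)%Z.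

Definition res1 (a : int) (p : nat) : int :=
  if res0 a p == 0%R then (p%:Z)%R else res0 a p.

(* The parameters [n], [k] below stand for the decomposition x = 12 n + k;
   only the values k = 2, 4, 8, 10 are meaningful. *)
Definition setS (n k : nat) : {fset nat} :=
  if k == 4 then [fset 12 * m + 6 | m in iota 0 n]
  else if k == 8 then [fset 12 * m + 6 | m in iota 0 n.+1]
  else [fset 12 * m | m in iota 1 n].

Definition Fplus (n k p : nat) : {fset nat} :=
  let x := 12 * n + k in
  [fset y in setS n k | p %| x + y].

Definition Fminus (n k p : nat) : {fset nat} :=
  let x := 12 * n + k in
  [fset y in setS n k | ((p%:Z)%R %| (x%:Z - y%:Z)%R)%Z
                        && ((x%:Z - y%:Z)%R != (2%:Z * p%:Z)%R)].

(* 3 < p < sqrt x, for p prime. *)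
Definition sieving_prime (x p : nat) : bool :=
  [&& prime p, 3 < p & p ^ 2 < x].

Definition f_count (n k : nat) : nat :=
  let x := 12 * n + k in
  #|` \bigcup_(p <- iota 0 x | sieving_prime x p)
        (Fplus n k p `|` Fminus n k p) |.

Definition par_n1 (n k : nat) : nat := if k == 8 then n.+1 else n.

Definition par_b (k : nat) : nat := if k \in [:: 4; 8] then 6 else 12.

Definition par_c (k : nat) : int := if k \in [:: 4; 10] then 1%R else (-1)%R.

Definition par_k1 (n k p : nat) : int :=
  let x := ((12 * n + k)%N%:Z)%R in
  (res0 ((p%:Z - res1 x p - (par_b k)%:Z) * 12%:Z ^+ (p - 2)) p + 1)%R.

Definition par_k2 (n k p : nat) : int :=
  let x := ((12 * n + k)%N%:Z)%R in
  (res0 ((x - (par_b k)%:Z) * 12%:Z ^+ (p - 2)) p + 1)%R.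

(* Main.v *)
Require Import Defs.
From mathcomp Require Import all_boot all_order all_algebra.
From mathcomp Require Import zify ring.

Import GRing.Theory.

(** Write x = 12 n + k and h = x / 2.  A neighbour y of x is a number h + z and
    a number h - z, z = y / 2, of which the first is an odd prime and the
    second an odd prime or 1.  As 3 does not divide h, when 3 does not divide z
    one of h - z, h + z is a multiple of 3; it can only be h - z = 3, and then
    y = x - 6 and h + z = x - 3.  This accounts for the extra neighbour when
    x - 3 is prime ([adj_off_setS]).  All the other candidates have 3 | z and z
    of the parity opposite to h, and these are exactly the members of S
    ([in_setS]), of which there are n_1.

    For y in S, both half-sums q_1 = (x + y) / 2 and q_2 = (x - y) / 2 are
    coprime to 6, so that Eratosthenes' sieve decides their primality with the
    primes 3 < p < sqrt x alone ([sieveP]): y fails to be a neighbour exactly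
    when such a p is a proper divisor of q_1 or q_2.  A p dividing q_1 is
    automatically proper, since q_1 > x / 2, whereas p = q_2 is the case
    x - y = 2p excluded from F(x,p,-).  Hence the non-neighbours in S form the
    union of the sets F(x,p,+) and F(x,p,-) ([adj_setS]), and the degree
    formula follows ([degree_near_goldbach]).

    For the count at a single p, S is the progression 12 i + b, 0 <= i < n_1.
    By Fermat 12^(p-2) inverts 12 modulo p, so a residue condition on y turns
    into one on i ([dvdz_progression]), which is met by
    floor((n_1 - (r + 1)) / p) + 1 of the indices, r being the residue
    ([count_residue]).  When p | x, F(x,p,-) lies inside F(x,p,+); otherwise
    the two are disjoint, because p does not divide 2x.  Finally x - 2p, which
    is missing from F(x,p,-), belongs to S iff 3 | p + c
    ([mem_last_exclusion]), hence the difference between the last two cases. *)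

Local Open Scope fset_scope.
Local Open Scope nat_scope.

(* Keeps [iota 0 n.+1] in the shape that [mem_iota] rewrites. *)
Local Arguments iota : simpl never.

(** * Counting a residue class in an initial segment *)

Lemma fsize_eq_mem (T : choiceType) (A : {fset T}) (s : seq T) :
  uniq s -> A =i s -> #|` A| = size s.
Proof. by move=> us eqAs; exact/perm_size/uniq_perm. Qed.

Lemma count_residue (p r n : nat) : r < p ->
  ((count (fun i => (i %% p == r)%N) (iota 0 n))%N%:Z)%R
    = (((n%:Z - (r%:Z + 1)) %/ p%:Z)%Z + 1)%R.
Proof.
move=> ltrp; have p0 : 0 < p by lia.
(* Adding p keeps the natural subtraction exact: r + 1 <= p. *)
have -> : count (fun i => i %% p == r) (iota 0 n) = (n + p - r.+1) %/ p.
  elim: n => [|n IHn]; first by rewrite divn_small //=; lia.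
  rewrite -[in iota _ _]addn1 iotaD count_cat IHn /= addn0.
  have -> : n.+1 + p - r.+1 = (n + p - r.+1).+1 by lia.
  rewrite divnS // addnC; congr (nat_of_bool _ + _).
  have -> : (n + p - r.+1).+1 = n + p - r by lia.
  rewrite -eqn_mod_dvd; last by lia.
  by rewrite modnDr (modn_small ltrp).
rewrite -divz_nat.
have -> : (n + p - r.+1)%:Z%R = (1 * p%:Z + (n%:Z - (r%:Z + 1)))%R by lia.
by rewrite divzMDl; [rewrite addrC | lia].
Qed.

(** * The set S as an arithmetic progression *)

(** Fermat's little theorem gives 12 * (12 * 12^(p-2)) = 12 modulo p, and 12
    can be cancelled because p > 3. *)
Lemma inverse12 (p : nat) : prime p -> 3 < p ->
  (p%:Z%R %| (12%:Z * 12%:Z ^+ (p - 2) - 1)%R)%Z.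
Proof.
move=> pp p3.
have cop : coprime p 12.
  by rewrite prime_coprime // (_ : 12 = 2 * 2 * 3) //
    !Euclid_dvdM // !dvdn_prime2 //; lia.
rewrite -exprS; have -> : (p - 2).+1 = p.-1 by lia.
rewrite -(@Gauss_dvdzr _ 12%:Z%R) //.
rewrite mulrBr mulr1 -exprS prednK ?prime_gt0 //.
rewrite -eqz_mod_dvd -rmorphXn /= !modz_nat eqz_nat; exact/eqP/fermat_little.
Qed.

(** Multiplying by 12^(p-2) solves 12 i + b = a modulo p for i; the absolute
    value only turns the nonnegative residue into a natural number. *)
Lemma dvdz_progression (p b i : nat) (a : int) : prime p -> 3 < p ->
  (p%:Z%R %| ((12 * i + b)%N%:Z - a)%R)%Z
    = (i %% p == `|res0 ((a - b%:Z) * 12%:Z ^+ (p - 2))%R p|%N).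
Proof.
move=> pp p3; have p0 : (p%:Z != 0)%R by lia.
have inv := inverse12 p pp p3.
set u := (12%:Z ^+ (p - 2))%R in inv *.
have -> : (i %% p == `|res0 ((a - b%:Z) * u)%R p|%N)
    = (p%:Z%R %| (i%:Z - (a - b%:Z) * u)%R)%Z.
  by rewrite -eqz_mod_dvd -eqz_nat gez0_abs ?modz_ge0 // -modz_nat.
apply/idP/idP => H.
- have -> : (i%:Z - (a - b%:Z) * u = u * ((12 * i + b)%N%:Z - a)
     - i%:Z * (12%:Z * u - 1))%R.
    by rewrite PoszD PoszM; ring.
  by rewrite rpredB // dvdz_mull.
- have -> : ((12 * i + b)%N%:Z - a = 12%:Z * (i%:Z - (a - b%:Z) * u)
     + (a - b%:Z) * (12%:Z * u - 1))%R.
    by rewrite PoszD PoszM; ring.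
  by rewrite rpredD // dvdz_mull.
Qed.

Lemma mem_setS n k y : k \in [:: 2; 4; 8; 10] ->
  (y \in setS n k) =
    (y \in [seq 12 * i + par_b k | i <- iota 0 (par_n1 n k)]).
Proof.
rewrite !inE /setS /par_b /par_n1 => hk; apply/idP/mapP => [|[i]].
  case/or4P: hk => /eqP-> /= /imfsetP[m /=]; rewrite mem_iota => hm ->.
  - by exists m.-1; rewrite ?mem_iota; lia.
  - by exists m; rewrite ?mem_iota; lia.
  - by exists m; rewrite ?mem_iota; lia.
  - by exists m.-1; rewrite ?mem_iota; lia.
case/or4P: hk => /eqP-> /=; rewrite mem_iota => hi ->; apply/imfsetP.
- by exists i.+1; rewrite /= ?mem_iota; lia.
- by exists i; rewrite //= ?mem_iota; lia.
- by exists i; rewrite //= ?mem_iota; lia.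
- by exists i.+1; rewrite /= ?mem_iota; lia.
Qed.

(** S in congruence form: the bounds on m in its three definitions amount to
    0 < y < x. *)
Lemma in_setS n k y : k \in [:: 2; 4; 8; 10] ->
  (y \in setS n k) =
    [&& y %% 12 == par_b k %% 12, 0 < y & y < 12 * n + k].
Proof.
move=> hk; rewrite (mem_setS _ _ _ hk).
have hb : 0 < par_b k by move: hk; rewrite !inE => /or4P[]/eqP->.
apply/mapP/and3P => [[i]|[/eqP hy y0 yx]].
  rewrite mem_iota => hi ->; move: hi hk; rewrite !inE /par_n1 /par_b.
  by move=> hi /or4P[]/eqP kE; move: hi; rewrite kE /= => hi; split; lia.
exists ((y - par_b k) %/ 12); rewrite ?mem_iota.
all: move: hk y0 yx hy; rewrite !inE /par_n1 /par_b.
all: by move=> /or4P[]/eqP-> /=; lia.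
Qed.

Lemma card_setS n k (P : pred nat) : k \in [:: 2; 4; 8; 10] ->
  #|` [fset y in setS n k | P y]|
    = count (fun i => P (12 * i + par_b k)) (iota 0 (par_n1 n k)).
Proof.
move=> hk.
set s := [seq 12 * i + par_b k | i <- iota 0 (par_n1 n k)].
rewrite (@fsize_eq_mem _ _ [seq y <- s | P y]).
- by rewrite size_filter count_map.
- by rewrite filter_uniq // map_inj_uniq ?iota_uniq // => i j /eqP; lia.
- by move=> y; rewrite !(in_fsetE, inE) /= mem_setS // mem_filter andbC.
Qed.

Lemma card_residue_class n k p (a : int) :
  k \in [:: 2; 4; 8; 10] -> prime p -> 3 < p ->
  (#|` [fset y in setS n k | (p%:Z%R %| (y%:Z - a)%R)%Z]|)%:Z%R
    = ((((par_n1 n k)%:Z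
         - (res0 ((a - (par_b k)%:Z) * 12%:Z ^+ (p - 2)) p + 1)) %/ p%:Z)%Z
       + 1)%R.
Proof.
move=> hk pp p3; have p0 : (p%:Z != 0)%R by lia.
rewrite card_setS //=.
rewrite (eq_count (fun i => dvdz_progression p (par_b k) i a pp p3)).
set r := res0 _ p.
have r0 : (0 <= r)%R by rewrite modz_ge0.
rewrite count_residue ?gez0_abs //.
by rewrite -ltz_nat gez0_abs //; apply: ltz_pmod; lia.
Qed.

(** * The size of F(x,p,+) and F(x,p,-) together *)

(** The bounds 0 < x - 2p < x hold since p^2 < x, so only x - 2p = b modulo 12
    matters.  Modulo 4 it holds as p is odd, and modulo 3 it reads
    p + c = 0 in each of the four cases for k. *)
Lemma mem_last_exclusion n k p :
  0 < n -> k \in [:: 2; 4; 8; 10] -> prime p -> 3 < p -> p ^ 2 < 12 * n + k ->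
  (12 * n + k - 2 * p \in setS n k) = (3%:Z%R %| (p%:Z + par_c k)%R)%Z.
Proof.
move=> hn hk pp p3 px; rewrite in_setS //.
have po : odd p by case: (even_prime pp) => // p2; lia.
have hx : 2 * p < 12 * n + k by nia.
move: hk hx; rewrite !inE /par_c /par_b => /or4P[]/eqP-> /=; lia.
Qed.

(** Inclusion-exclusion: F(x,p,-) is the residue class D of x without the point
    x - 2p, and F(x,p,+) is the residue class of -x. *)
Lemma card_sieve_class n k p :
  0 < n -> k \in [:: 2; 4; 8; 10] -> prime p -> 3 < p -> p ^ 2 < 12 * n + k ->
  let n1 := ((par_n1 n k)%:Z)%R in
  let k1 := par_k1 n k p in
  let k2 := par_k2 n k p in
  (#|` Fplus n k p `|` Fminus n k p |)%:Z%R =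
    if p %| 12 * n + k then (((n1 - k1)%R %/ p%:Z%R)%Z + 1)%R
    else if (3%:Z%R %| (p%:Z + par_c k)%R)%Z then
      (((n1 - k1)%R %/ p%:Z%R)%Z + ((n1 - k2)%R %/ p%:Z%R)%Z + 1)%R
    else
      (((n1 - k1)%R %/ p%:Z%R)%Z + ((n1 - k2)%R %/ p%:Z%R)%Z + 2)%R.
Proof.
move=> hn hk pp p3 px n1 k1 k2.
set x := 12 * n + k in px *.
have h2p : 2 * p <= x by nia.
pose D := [fset y in setS n k | (p%:Z%R %| (y%:Z - x%:Z)%R)%Z].
have cardD : (#|` D|%:Z = ((n1 - k2) %/ p%:Z)%Z + 1)%R.
  exact: card_residue_class.
have FmE : Fminus n k p = D `\ (x - 2 * p).
  apply/fsetP => y; rewrite !(in_fsetE, inE) /= -/x.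
  rewrite -[(p%:Z%R %| (x%:Z - y%:Z)%R)%Z]rpredN opprB /=.
  case: (boolP (y \in setS n k)); rewrite ?andbF ?andbT //=.
  rewrite in_setS // => /and3P[_ _ yx].
  rewrite andbC; congr (_ && _).
  apply/idP/idP => /eqP h; apply/eqP; lia.
have res1E : (p%:Z%R %| (x%:Z - res1 x p)%R)%Z.
  rewrite /res1 /res0; case: eqP => [h|_].
    by rewrite rpredB ?dvdzz //; apply/dvdz_mod0P.
  by rewrite -eqz_mod_dvd modz_mod.
(* p - [x]_p^1 represents -x modulo p. *)
have FpE : Fplus n k p
    = [fset y in setS n k | (p%:Z%R %| (y%:Z - (p%:Z - res1 x p))%R)%Z].
  apply/fsetP => y; rewrite !(in_fsetE, inE) /=; congr (_ && _).
  have -> : (y%:Z - (p%:Z - res1 x p)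
      = (x + y)%N%:Z - (x%:Z - res1 x p) - p%:Z)%R.
    by rewrite PoszD; ring.
  by rewrite rpredBr ?dvdzz // rpredBr.
have cardFp : (#|` Fplus n k p|%:Z = ((n1 - k1) %/ p%:Z)%Z + 1)%R.
  by rewrite FpE card_residue_class.
have memFm : (x - 2 * p \in D) = (3%:Z%R %| (p%:Z + par_c k)%R)%Z.
  rewrite !(in_fsetE, inE) /= mem_last_exclusion // andb_idr // => _.
  rewrite -subzn // addrAC subrr sub0r rpredN.
  by rewrite PoszM dvdz_mull.
have p2 : coprime p 2.
  rewrite coprime_sym prime_coprime // dvdn2 negbK.
  by case: (even_prime pp) => // ?; lia.
case: ifP => [pdx|pndx].
  suff -> : Fplus n k p `|` Fminus n k p = Fplus n k p by [].
  apply/fsetUidPl/fsubsetP => y.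
  rewrite FmE !(in_fsetE, inE) /= => /and3P[_ -> pyx] /=.
  rewrite dvdn_addr //; rewrite rpredBr // in pyx.
have disj : Fplus n k p `&` Fminus n k p = fset0.
  apply/fsetP => y; rewrite FmE !(in_fsetE, inE) /=; apply/negbTE/negP.
  move=> /andP[/andP[_ pxy]] /and3P[_ _ pyx].
  (* A common element would give p | (x + y) + (x - y) = 2x. *)
  move/negP: pndx; apply; rewrite -(Gauss_dvdr _ p2).
  have : (p%:Z%R %| ((x + y)%N%:Z - (y%:Z - x%:Z))%R)%Z by rewrite rpredB.
  by have -> : ((x + y)%N%:Z - (y%:Z - x%:Z) = (2 * x)%N%:Z)%R by lia.
have := cardfsU (Fplus n k p) (Fminus n k p).
rewrite disj cardfs0 subn0 FmE => ->.
have cardDm : ((#|` D `\ (x - 2 * p)%N|)%:Z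
    = ((n1 - k2) %/ p%:Z)%Z + 1
       - (nat_of_bool (3%:Z%R %| (p%:Z + par_c k)%R)%Z)%:Z)%R.
  by rewrite -cardD (cardfsD1 (x - 2 * p)%N D) memFm PoszD addrC addKr.
rewrite PoszD cardFp cardDm.
by case: ifP => _ /=; ring.
Qed.

(** * The degree of x *)

(** A composite q has a prime factor at most sqrt q, which exceeds 3 when q is
    coprime to 6.  Requiring p to be a proper divisor, instead of p^2 <= q,
    allows sieving with one and the same range of primes, p^2 < x, for every
    q < x. *)
Lemma sieveP (x q : nat) : odd q -> ~~ (3 %| q) -> q < x ->
  reflect (exists p, [/\ sieving_prime x p, p %| q & p != q])
          (~~ (prime q || (q == 1))).
Proof.
move=> oq q3 qx; apply: (iffP idP) => [|[p [/and3P[pp p3 px] pq npq]]].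
  rewrite negb_or => /andP[/primePns[q2|[p [pp ppq pq]]] q1].
    by move: oq q1; case: q q2 {q3 qx} => [|[|]].
  have p2 : p != 2 by apply: contraTneq oq => p2; rewrite -dvdn2 -p2.
  have p3 : p != 3 by apply: contraNneq q3 => <-.
  have pgt1 := prime_gt1 pp.
  exists p; split=> //; last by nia.
  by rewrite /sieving_prime pp /=; apply/andP; split; lia.
rewrite negb_or; apply/andP; split.
  by apply: contraNN npq => pq'; rewrite -dvdn_prime2.
by apply: contraTneq pq => ->; rewrite dvdn1; case: (p) p3 => [|[]].
Qed.

(** The elements of S that are struck out, whose number is f(n). *)
Definition sieved (n k : nat) : {fset nat} :=
  let x := 12 * n + k in
  \bigcup_(p <- iota 0 x | sieving_prime x p) (Fplus n k p `|` Fminus n k p).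

Lemma sievedP n k y : k \in [:: 2; 4; 8; 10] -> y \in setS n k ->
  reflect (exists2 p, sieving_prime (12 * n + k) p &
    (p %| 12 * n + k + y) \/
    (p%:Z%R %| ((12 * n + k)%N%:Z - y%:Z)%R)%Z /\ 12 * n + k - y != 2 * p)
    (y \in sieved n k).
Proof.
move=> hk yS; rewrite /sieved; cbv zeta.
have eqN p : ((12 * n + k)%N%:Z - y%:Z != 2%:Z * p%:Z)%R
    = (12 * n + k - y != 2 * p).
  move: (yS); rewrite in_setS // => /and3P[_ _ yx].
  by apply/idP/idP => /eqP h; apply/eqP; lia.
apply: (iffP (bigfcupP _ _ _ _)) => [[p /andP[_ sp]]|[p sp H]].
  rewrite !(in_fsetE, inE) /= yS eqN /= => /orP h; exists p => //.
  by case: h => [|/andP[]]; [left | right].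
exists p; last first.
  rewrite !(in_fsetE, inE) /= yS eqN; apply/orP.
  by case: H => [|/andP]; auto.
by rewrite sp andbT mem_iota; case/and3P: sp; nia.
Qed.

(** The half-sums q1 and q2 of y in S are coprime to 6 and below x, so that
    [sieveP] applies to both of them. *)
Lemma adj_setS n k y : 0 < n -> k \in [:: 2; 4; 8; 10] -> y \in setS n k ->
  near_goldbach_adj (12 * n + k)./2 (12 * n + k) y = (y \notin sieved n k).
Proof.
move=> hn hk yS.
have : [&& y %% 12 == par_b k %% 12, 0 < y & y < 12 * n + k].
  by rewrite -in_setS.
case/and3P => hy y0.
set x := 12 * n + k => yx.
have [q1 [q2 [[xq yq q2x] [oq1 oq2 q13 q23]]]] : exists q1 q2,
    [/\ x = q1 + q2, y = q1 - q2 & q2 < q1]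
    /\ [/\ odd q1, odd q2, ~~ (3 %| q1) & ~~ (3 %| q2)].
  exists (x + y)./2, (x - y)./2; move: hk hy; rewrite !inE /par_b /x.
  by move=> /or4P[]/eqP kE; rewrite kE /=; split; split; lia.
have q20 : 0 < q2 by case: (q2) oq2.
have q1x : q1 < x by lia.
have -> : near_goldbach_adj x./2 x y = prime q1 && (prime q2 || (q2 == 1)).
  rewrite /near_goldbach_adj /odd_prime_below_or_1.
  have -> : `|(x%:Z - y%:Z)%R|%N./2 = q2 by lia.
  have -> : (x + y)./2 = q1 by lia.
  have xE : x = 2 * x./2.
    by move: hk; rewrite /x !inE => /or4P[]/eqP->; lia.
  rewrite -xE; have -> /= : x != y by lia.
  have -> : (q1 == 1) = false by lia.
  rewrite orbF q1x (_ : q2 < x) ?andbT; last by lia.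
  congr (_ && (_ || _)); apply: andb_idr => /prime_gt1; lia.
have sq1 := sieveP _ _ oq1 q13 q1x.
have sq2 := sieveP _ _ oq2 q23 (ltn_trans q2x q1x).
have -> : prime q1 = prime q1 || (q1 == 1) by lia.
rewrite -[LHS]negbK negb_and; congr (~~ _).
have x2 : x + y = 2 * q1 by lia.
have y2 : (x%:Z - y%:Z = (2 * q2)%N%:Z)%R by lia.
have dvd2 p q : sieving_prime x p -> (p %| 2 * q) = (p %| q).
  move=> /and3P[pp p3 _]; rewrite Gauss_dvdr //.
  rewrite coprime_sym prime_coprime // dvdn2 negbK.
  by case: (even_prime pp) => // ?; lia.
apply/idP/(sievedP _ _ _ hk yS) => [/orP[/sq1|/sq2] [p [sp pq npq]]|[p sp]].
- by exists p => //; left; rewrite x2 dvdn_mull.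
- exists p => //; right; split; last by lia.
  by rewrite y2; apply: dvdn_mull.
- rewrite x2 y2 (dvd2 _ _ sp) => -[pq|[]].
    apply/orP; left; apply/sq1; exists p; split=> //.
    (* p = q1 is impossible: q1 > x / 2, but p^2 < x. *)
    by case/and3P: sp => _ p3 px; nia.
  rewrite -[(_ %| _)%Z]/(p %| 2 * q2) (dvd2 _ _ sp) => pq npq.
  by apply/orP; right; apply/sq2; exists p; split=> //; lia.
Qed.

(** A vertex y outside S either has the wrong parity, so that the half-sums
    are even, or has a half-sum divisible by 3; a prime multiple of 3 is 3 itself. *)
Lemma adj_off_setS n k y : 0 < n -> k \in [:: 2; 4; 8; 10] ->
  y \notin setS n k ->
  (y \in vertices (near_goldbach (12 * n + k)./2))
      && near_goldbach_adj (12 * n + k)./2 (12 * n + k) y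
    = prime (12 * n + k - 3) && (y == 12 * n + k - 6).
Proof.
move=> hn hk; rewrite in_setS //.
set x := 12 * n + k => yS.
have xE : x = 2 * x./2.
  by move: hk; rewrite /x !inE => /or4P[]/eqP->; lia.
have x3 : ~~ (3 %| x).
  by move: hk; rewrite /x !inE => /or4P[]/eqP->; lia.
have x14 : 13 < x by move: hk; rewrite /x !inE => /or4P[]/eqP->; lia.
rewrite /near_goldbach_adj /odd_prime_below_or_1 -xE.
apply/andP/andP => [[/imfsetP[i /=]]|[px /eqP ->]].
  rewrite mem_iota => hi yi /and3P[nxy].
  have -> : `|(x%:Z - y%:Z)%R|%N./2 = x./2 - i by lia.
  have -> : (x + y)./2 = x./2 + i by lia.
  have -> : (x./2 + i == 1) = false by lia.
  rewrite orbF => /and3P[p1 p12 p1x] q2.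
  have n31 : ~~ (3 %| x./2 + i) by rewrite dvdn_prime2 //; lia.
  have [d3|nd3] := boolP (3 %| x./2 - i).
    have q23 : x./2 - i = 3.
      case/orP: q2 => [/and3P[p2 _ _]|/eqP h]; last by rewrite h in d3.
      by apply/eqP; rewrite eq_sym -dvdn_prime2.
    have -> : y = x - 6 by lia.
    by rewrite (_ : x - 3 = x./2 + i) //; lia.
  have op1 : odd (x./2 + i) by case: (even_prime p1) => //; lia.
  case/negP: yS; move: hk xE x3; rewrite /x /par_b !inE => /or4P[]/eqP kE;
  by move: op1 n31 nd3 nxy yi hi; rewrite /x kE /=; lia.
split; first by apply/imfsetP; exists (x./2 - 3); rewrite /= ?mem_iota; lia.
have -> : `|(x%:Z - (x - 6)%N%:Z)%R|%N./2 = 3 by lia.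
have -> : (x + (x - 6))./2 = x - 3 by lia.
by apply/and3P; split; rewrite ?px //=; lia.
Qed.

(** Stated additively to avoid truncated subtraction; here the boolean
    primality of x - 3 counts as 0 or 1. *)
Lemma degree_near_goldbach n k : 0 < n -> k \in [:: 2; 4; 8; 10] ->
  degree (near_goldbach (12 * n + k)./2) (12 * n + k) + f_count n k
    = par_n1 n k + prime (12 * n + k - 3).
Proof.
move=> hn hk; set x := 12 * n + k.
pose E : {fset nat} := if prime (x - 3) then [fset x - 6] else fset0.
have memE y : (y \in E) = prime (x - 3) && (y == x - 6).
  by rewrite /E; case: ifP; rewrite in_fsetE.
have SE : x - 6 \notin setS n k.
  rewrite in_setS // /x; move: hk; rewrite !inE /par_b => /or4P[]/eqP-> /=; lia.
have -> : degree (near_goldbach x./2) x = #|` (setS n k `\` sieved n k) `|` E |.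
  congr (#|` _|); apply/fsetP => y; rewrite !(in_fsetE, inE) /= memE.
  have [yS|yS] := boolP (y \in setS n k).
    rewrite adj_setS // andbT.
    have -> : (y == x - 6) = false by apply: contraTF yS => /eqP ->.
    rewrite andbF orbF andb_idl // => _; apply/imfsetP; exists y./2.
      move: yS; rewrite in_setS // mem_iota => /and3P[].
      by move: hk; rewrite /x !inE /par_b => /or4P[]/eqP-> /=; lia.
    move: yS; rewrite in_setS // => /and3P[].
    by move: hk; rewrite /x !inE /par_b => /or4P[]/eqP-> /=; lia.
  by rewrite andbF /=; apply: adj_off_setS.
have sub : sieved n k `<=` setS n k.
  apply/fsubsetP => y /bigfcupP[p _].
  by rewrite !(in_fsetE, inE) /= => /orP[]/andP[].
have cS : #|` setS n k| = par_n1 n k.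
  have := card_setS n k predT hk; rewrite count_predT size_iota => <-.
  by congr (#|` _|); apply/fsetP => y; rewrite !(in_fsetE, inE) /= andbT.
rewrite cardfsU (_ : _ `&` E = fset0) ?cardfs0 ?subn0; last first.
  apply/fsetP => y; rewrite !(in_fsetE, inE) memE; apply/negbTE.
  by apply: contraNN SE => /andP[/andP[_ +] /andP[_ /eqP <-]].
rewrite cardfsD (fsetIidPr sub) cS.
have <- : #|` E| = prime (x - 3).
  by rewrite /E; case: ifP; rewrite ?cardfs1 ?cardfs0.
have := fsubset_leq_card sub; rewrite cS -/(f_count n k); lia.
Qed.

Theorem theorem4p1 (n k x : nat) (hn : 0 < n) (hk : k \in [:: 2; 4; 8; 10])
    (hx : x = 12 * n + k) :
  let n1 := ((par_n1 n k)%:Z)%R in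
  (((degree (near_goldbach x./2) x)%:Z)%R =
     if prime (x - 3) then (n1 + 1 - (f_count n k)%:Z)%R
     else (n1 - (f_count n k)%:Z)%R)
  /\
  (forall p : nat, prime p -> 3 < p -> p ^ 2 < x ->
     let k1 := par_k1 n k p in
     let k2 := par_k2 n k p in
     (#|` Fplus n k p `|` Fminus n k p |)%:Z%R =
       if p %| x then (((n1 - k1)%R %/ p%:Z%R)%Z + 1)%R
       else if (3%:Z%R %| (p%:Z + par_c k)%R)%Z then
         (((n1 - k1)%R %/ p%:Z%R)%Z + ((n1 - k2)%R %/ p%:Z%R)%Z + 1)%R
       else
         (((n1 - k1)%R %/ p%:Z%R)%Z + ((n1 - k2)%R %/ p%:Z%R)%Z + 2)%R).
Proof.
move=> n1; rewrite hx; split; last by move=> p; exact: card_sieve_class.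
have := degree_near_goldbach _ _ hn hk.
by case: ifP => _ /=; rewrite /n1; lia.
Qed.
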